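(* Let $G$ be a finite daisy cube and let $b$ be the number of its two-sided peripheral $\Theta$-classes. Then $G$ has exactly $2^b$ equivalence classes of minimum-dimensional proper embeddings, where embeddings that differ only by a permutation of coordinates are identified.
   Context: All graphs are finite, simple and connected. $Q_n$ is the hypercube on $\{0,1\}^n$. A partial cube is a graph isomorphic to an isometric (distance-preserving) subgraph of a hypercube. For edges $ab,xy$ of a partial cube $G$, $ab\,\Theta\,xy$ iff $d(a,x)+d(b,y)\ne d(a,y)+d(b,x)$; this is an equivalence relation on $E(G)$ whose classes are the $\Theta$-classes; their number $m$ is the isometric dimension of $G$. The $\Theta$-class of an edge $ab$ determines two complementary halfspaces $W_{ab}=\{x:d(a,x)<d(b,x)\}$ and $W_{ba}=\{x:d(b,x)<d(a,x)\}$. For a $\Theta$-class $\theta$ and one of its halfspaces $W$, let $U(\theta,W)$ be the set of vertices of $W$ incident with an edge of $\theta$. The class $\theta$ is two-sided peripheral if $U(\theta,W)=W$ for both of its halfspaces $W$. A daisy cube is a graph isomorphic to the induced subgraph $Q_n[D]$ for some $n\ge0$ and some nonempty down-set $D\subseteq\{0,1\}^n$ (coordinatewise order); every daisy cube is a partial cube. A minimum-dimensional proper embedding of a daisy cube $G$ of isometric dimension $m$ is an isometric embedding $\lambda:V(G)\to\{0,1\}^m$ (into $Q_m$) whose image $\lambda(V(G))$ is a down-set. *)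

(* Defs.v *)
From mathcomp Require Import all_boot all_order all_fingroup.

Set Implicit Arguments.
Unset Strict Implicit.
Unset Printing Implicit Defensive.

(* A graph is an adjacency relation [e : rel T] on a finite type [T] of         *)
(* vertices; symmetry, irreflexivity and connectedness are stated separately.   *)

Section Distance.

Variables (T : finType) (e : rel T).

Definition walk (k : nat) (x y : T) : bool :=
  [exists p : k.-tuple T, path e x p && (last x p == y)].

(* Length of a shortest walk. In a connected graph that length is smaller than  *)
(* [#|T|], so bounding the search loses nothing; for vertices in different      *)
(* components the value is the junk value [#|T|].                               *)
Definition dist (x y : T) : nat := find (fun k => walk k x y) (iota 0 #|T|).

End Distance.

Section Hypercube.

Variable n : nat.

Definition cube : finType := {ffun 'I_n -> bool}.

Definition cube_adj : rel cube :=
  fun x y => #|[set i | x i != y i]| == 1.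

Definition cube_le (x y : cube) : bool := [forall i, (x i <= y i)%O].

Definition down_set (D : {set cube}) : bool :=
  [forall y in D, forall x, cube_le x y ==> (x \in D)].

End Hypercube.

Section Theta.

Variables (T : finType) (e : rel T).

Definition edges : {set {set T}} :=
  [set E | [exists a, exists b, e a b && (E == [set a; b])]].

(* The condition on [a, b, x, y] is invariant under exchanging [a] with [b] and *)
(* [x] with [y], so the choice of the orientations does not matter.             *)
Definition Theta : rel {set T} := fun E F =>
  [exists a, exists b, exists x, exists y,
    [&& E == [set a; b], F == [set x; y] &
        dist e a x + dist e b y != dist e a y + dist e b x]].

Definition Theta_classes : {set {set {set T}}} :=
  equivalence_partition Theta edges.

Definition isometric_dim : nat := #|Theta_classes|.

Definition Wset (a b : T) : {set T} := [set x | dist e a x < dist e b x].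

Definition halfspace (theta : {set {set T}}) (W : {set T}) : bool :=
  [exists a, exists b, ([set a; b] \in theta) && (W == Wset a b)].

Definition Uset (theta : {set {set T}}) (W : {set T}) : {set T} :=
  [set x in W | [exists E in theta, x \in E]].

Definition two_sided_peripheral (theta : {set {set T}}) : bool :=
  [forall W, halfspace theta W ==> (Uset theta W == W)].

Definition daisy_cube : Prop :=
  exists (n : nat) (D : {set cube n}) (f : T -> cube n),
    [/\ D != set0, down_set D, injective f, f @: [set: T] = D &
        forall x y, e x y = cube_adj (f x) (f y)].

Section Embeddings.

Variable m : nat.

Definition isometric_embedding (f : {ffun T -> cube m}) : bool :=
  [forall x, forall y, dist (@cube_adj m) (f x) (f y) == dist e x y].

Definition proper_embeddings : {set {ffun T -> cube m}} :=
  [set f | isometric_embedding f && down_set (f @: [set: T])].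

Definition coord_perm_equiv : rel {ffun T -> cube m} := fun f g =>
  [exists s : 'S_m, [forall x, forall i, g x i == f x (s i)]].

Definition proper_embedding_classes : {set {set {ffun T -> cube m}}} :=
  equivalence_partition coord_perm_equiv proper_embeddings.

End Embeddings.

End Theta.

(* Main.v *)
Require Import Defs.
From mathcomp Require Import all_boot all_order all_fingroup.

Set Implicit Arguments.
Unset Strict Implicit.
Unset Printing Implicit Defensive.

(** Isometry into a hypercube turns [Theta] into the relation of flipping the
    same coordinate ([Theta_classesE]). An isometric embedding in the minimum
    dimension therefore has exactly one coordinate for each class, and that
    coordinate is the indicator function of one of the two halfspaces. Up to a
    permutation of coordinates, all such embeddings arise from a single one, [f],
    by choosing for each class which halfspace is sent to [true], that is, by
    translating [f] by a vector [c] ([isometry_rigid]), and different vectors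
    give inequivalent embeddings ([translate_rigid]).

    For the count, start from an [f] whose image [D] is a down-set
    ([exists_proper_embedding]). The translate of [D] by [c] is again a down-set
    exactly when [D] is closed under flipping each coordinate in the support of
    [c] ([down_set_translate]). Closure of [D] under flipping one coordinate says
    that every vertex has a neighbour across the corresponding class, which is
    two-sided peripherality ([two_sided_peripheralE]). So the classes of proper
    embeddings correspond to the sets of two-sided peripheral classes. *)

(** * Shortest walks *)

Section ShortestWalks.

Variables (T : finType) (e : rel T).

(** [dist] only examines lengths below [#|T|]; removing the repetitions from a
    walk brings its length below that bound. *)
Lemma short_walk x p : path e x p ->
  exists k, [/\ k <= size p, k < #|T| & walk e k x (last x p)].
Proof.
case/shortenP=> p' ep' Up' sub_p'p; exists (size p'); split.
- by apply: uniq_leq_size sub_p'p; case/andP: Up'.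
- by have := max_card (mem (x :: p')); rewrite (card_uniqP Up').
by apply/existsP; exists (in_tuple p'); rewrite /= ep' eqxx.
Qed.

Lemma dist_le_size x p : path e x p -> dist e x (last x p) <= size p.
Proof.
case/short_walk=> k [le_kp lt_kT wk]; apply: leq_trans le_kp.
rewrite leqNgt; apply/negP => /(before_find 0).
by rewrite nth_iota // add0n wk.
Qed.

Lemma dist_walk x y : connect e x y ->
  exists p, [/\ path e x p, last x p = y & size p = dist e x y].
Proof.
case/connectP=> p ep ->; have [k [_ lt_kT wk]] := short_walk ep.
have hasw : has (fun k => walk e k x (last x p)) (iota 0 #|T|).
  by apply/hasP; exists k; rewrite // mem_iota.
have := nth_find 0 hasw; move: (hasw); rewrite has_find size_iota => lt_d.
rewrite nth_iota // add0n => /existsP[q /andP[eq_q /eqP lq]].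
by exists q; rewrite size_tuple.
Qed.

Lemma connected_constant (A : Type) (g : T -> A) :
    (forall x y, connect e x y) -> (forall x y, e x y -> g x = g y) ->
  forall x y, g x = g y.
Proof.
move=> conn ge x y; case/connectP: (conn x y) => p.
elim: p x => [|z p IHp] x /=; first by move=> _ ->.
by case/andP=> /ge-> ep /(IHp _ ep).
Qed.

End ShortestWalks.

(** * The Hamming metric on the hypercube *)

Section Hamming.

Variable n : nat.
Implicit Types (x y z c : cube n) (i : 'I_n).

Definition ham x y : nat := #|[set i | x i != y i]|.

Definition flip x i : cube n := [ffun j => x j (+) (j == i)].

Definition translate c x : cube n := [ffun j => x j (+) c j].

Lemma hamE x y : ham x y = \sum_i (x i != y i).
Proof. by rewrite /ham -sum1dep_card big_mkcond; apply: eq_bigr => i _; case: (_ != _). Qed.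

Lemma ham0 x : ham x x = 0.
Proof. by rewrite hamE big1 // => i _; rewrite eqxx. Qed.

Lemma ham_sym x y : ham x y = ham y x.
Proof. by rewrite !hamE; apply: eq_bigr => i _; rewrite eq_sym. Qed.

Lemma ham_triangle x y z : ham x z <= ham x y + ham y z.
Proof.
rewrite !hamE -big_split leq_sum // => i _ /=.
by case: (x i) (y i) (z i) => [] [] [].
Qed.

Lemma flipK i : involutive (flip^~ i).
Proof. by move=> x; apply/ffunP=> j; rewrite !ffunE addbK. Qed.

Lemma ham_flip x i : ham x (flip x i) = 1.
Proof.
rewrite hamE (bigD1 i) //= ffunE eqxx big1 => [|j /negPf ne_ji].
  by case: (x i).
by rewrite ffunE ne_ji addbF eqxx.
Qed.

Lemma ham1_flip x y i : ham x y = 1 -> x i != y i -> y = flip x i.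
Proof.
rewrite hamE (bigD1 i) //= => h1 ne_i; move: h1; rewrite ne_i => /eqP.
rewrite eqSS sum_nat_eq0 => /forall_inP eq_xy.
apply/ffunP=> j; rewrite ffunE; have [->|ne_ji] := eqVneq j i.
  by move: ne_i; case: (x i) (y i) => [] [].
by rewrite addbF; move: (eq_xy j ne_ji); rewrite eqb0 negbK => /eqP.
Qed.

Lemma ham1_exists x y : ham x y = 1 -> exists2 i, x i != y i & y = flip x i.
Proof.
move=> h1; have /card_gt0P[i] : 0 < #|[set i | x i != y i]| by rewrite -/(ham x y) h1.
by rewrite inE => ne_i; exists i => //; apply: ham1_flip.
Qed.

Lemma ham_flip_ne x y i : x i != y i -> ham x y = (ham (flip x i) y).+1.
Proof.
move=> ne_i; rewrite !hamE !(bigD1 i (P := predT)) //= ffunE eqxx.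
rewrite (eq_bigr (fun j => (flip x i j != y j) : nat)) => [|j /negPf ne_ji].
  by move: ne_i; case: (x i) (y i) => [] [].
by rewrite ffunE ne_ji addbF.
Qed.

Lemma ham_flip_lt x y i : (ham x y < ham (flip x i) y) = (x i == y i).
Proof.
have [eq_i|ne_i] := eqVneq (x i) (y i); last first.
  by rewrite (ham_flip_ne ne_i) ltnNge leqnSn.
have ne_i : flip x i i != y i by rewrite ffunE eqxx -eq_i; case: (x i).
by rewrite (ham_flip_ne ne_i) flipK leqnn.
Qed.

(** The coordinates contribute independently to both sums, and their
    contributions differ only at a coordinate flipped both from [x] and from
    [y]. *)
Lemma ham_theta x y i j :
  (ham x y + ham (flip x i) (flip y j) != ham x (flip y j) + ham (flip x i) y)
    = (i == j).
Proof.
rewrite !hamE -!big_split /=.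
have [<-|ne_ij] := eqVneq i j.
  rewrite !(bigD1 i (P := predT)) //= !ffunE eqxx.
  set A := (X in _ + X != _); set B := (X in _ != _ + X).
  have -> : A = B.
    by apply: eq_bigr => k /negPf ne_ki; rewrite !ffunE ne_ki !addbF.
  by rewrite eqn_add2r; case: (x i) (y i) => [] [].
apply/negbTE; rewrite negbK; apply/eqP/eq_bigr => k _; rewrite !ffunE.
have [->|_] := eqVneq k i; first by rewrite (negPf ne_ij) !addbF.
by rewrite !addbF addnC.
Qed.

Lemma ham_translate c x y : ham (translate c x) (translate c y) = ham x y.
Proof.
rewrite !hamE; apply: eq_bigr => i _; rewrite !ffunE.
by case: (x i) (y i) (c i) => [] [] [].
Qed.

Lemma translateK c : involutive (translate c).
Proof. by move=> x; apply/ffunP=> i; rewrite !ffunE addbK. Qed.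

Lemma flip_translate c x i : flip (translate c x) i = translate c (flip x i).
Proof. by apply/ffunP=> j; rewrite !ffunE addbAC. Qed.

Lemma down_setP (D : {set cube n}) :
  reflect (forall x y, y \in D -> (forall i, x i -> y i) -> x \in D) (down_set D).
Proof.
apply: (iffP forall_inP) => [dD x y yD le_xy | dD y yD].
  have /forallP/(_ x)/implyP := dD y yD; apply.
  by apply/forallP=> i; move: (le_xy i); case: (x i) => // ->.
apply/forallP=> x; apply/implyP=> /forallP le_xy; apply: dD yD _ => i xi.
by move: (le_xy i); rewrite xi; case: (y i).
Qed.

Lemma down_set_flip (D : {set cube n}) x i :
  down_set D -> x \in D -> x i -> flip x i \in D.
Proof.
move=> /down_setP dD xD xi; apply: dD xD _ => j; rewrite ffunE.
by have [->|] := eqVneq j i; rewrite ?xi ?addbF.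
Qed.

End Hamming.

(** * Translates of down-sets *)

(** The coordinates on which [x] and [y] differ are flipped one after another. *)
Lemma flip_closed_mem n (D : {set cube n}) (x y : cube n) :
    (forall i z, x i != y i -> z \in D -> flip z i \in D) ->
  x \in D -> y \in D.
Proof.
have [k] := ubnP (ham x y); elim: k x => // k IHk x le_k closed xD.
have [i ne_i|eq_xy] := pickP (fun i => x i != y i); last first.
  suff <- : x = y by [].
  by apply/ffunP=> i; apply/eqP; move: (eq_xy i); case: eqVneq.
apply: (IHk (flip x i)); last exact: closed.
  by move: le_k; rewrite (ham_flip_ne ne_i).
move=> j z; rewrite ffunE; have [->|_] := eqVneq j i; first by move=> _; apply: closed.
by rewrite addbF; apply: closed.
Qed.

(** If the translate is a down-set and [c i] holds, then a point [x] of [D] with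
    [x i = false] is sent to a point whose [i]-th coordinate is true; lowering
    that coordinate there amounts to raising it in [D]. In the other direction
    [D] is invariant under translation by [c]. *)
Lemma down_set_translate n (D : {set cube n}) (c : cube n) : down_set D ->
  down_set (translate c @: D)
    = [forall i, c i ==> [forall x in D, flip x i \in D]].
Proof.
move=> dD; apply/idP/forallP => [dcD i | closed].
  apply/implyP=> ci; apply/forall_inP=> x xD.
  have [xi|nxi] := boolP (x i); first exact: down_set_flip.
  have: flip (translate c x) i \in translate c @: D.
    by apply: down_set_flip => //; rewrite ?imset_f // ffunE ci addbT.
  by rewrite flip_translate mem_imset //; apply: inv_inj (translateK c).
suff -> : translate c @: D = D by [].
apply/eqP; rewrite eqEcard card_imset ?leqnn ?andbT; last first.
  exact: inv_inj (translateK c).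
apply/subsetP=> _ /imsetP[x xD ->]; apply: flip_closed_mem xD => i z.
rewrite ffunE => ne_i zD; have ci : c i by move: ne_i; case: (c i) (x i) => [] [].
by move/implyP/(_ ci)/forall_inP/(_ z zD): (closed i).
Qed.

(** * Isometries and their coordinates *)

Section Isometries.

Variables (T : finType) (e : rel T) (n : nat).

Definition isometry (f : T -> cube n) : Prop :=
  forall x y, dist e x y = ham (f x) (f y).

(** A shortest path can be taken to descend from [f x] before it ascends to
    [f y], and so it stays below [f x] or [f y]. *)
Lemma down_set_isometry (f : T -> cube n) :
    down_set (f @: [set: T]) -> injective f ->
    (forall x y, e x y = cube_adj (f x) (f y)) ->
  isometry f.
Proof.
move=> dD f_inj fe.
(* Each step changes one coordinate, so no walk beats the Hamming distance. *)
have lower x p : path e x p -> ham (f x) (f (last x p)) <= size p.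
  elim: p x => [|y p IHp] x /=; first by rewrite ham0.
  case/andP; rewrite fe => /eqP h1 /IHp le_p.
  apply: leq_trans (ham_triangle _ (f y) _) _.
  by rewrite {1}/ham h1.
have fD x : f x \in f @: [set: T] by rewrite imset_f.
(* Lower a coordinate of [f x] where possible; when [f x] lies below [f y],
   lower one of [f y] instead. *)
have upper k x y : ham (f x) (f y) = k ->
    exists p, [/\ path e x p, last x p = y & size p = k].
  elim: k x y => [|k IHk] x y hk.
    exists [::]; split=> //=; apply: f_inj; apply/ffunP=> i.
    move/eqP: hk; rewrite hamE sum_nat_eq0 => /forall_inP/(_ i isT).
    by rewrite eqb0 negbK => /eqP.
  have [i /andP[xi yi]|noi] := pickP (fun i => f x i && ~~ f y i).
    have /imsetP[z _ fz] := down_set_flip dD (fD x) xi.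
    have ne_i : f x i != f y i by rewrite xi eq_sym eqb_id.
    move: hk; rewrite (ham_flip_ne ne_i) fz => -[/IHk[p [ep lp sp]]].
    exists (z :: p); rewrite /= ep lp sp fe /cube_adj -fz.
    by rewrite -/(ham _ _) ham_flip.
  have /card_gt0P[i] : 0 < #|[set i | f y i != f x i]|.
    by rewrite -/(ham (f y) (f x)) ham_sym hk.
  rewrite inE => ne_i.
  have yi : f y i by move: (noi i) ne_i; case: (f x i) (f y i) => [] [].
  have /imsetP[z _ fz] := down_set_flip dD (fD y) yi.
  move: hk; rewrite ham_sym (ham_flip_ne ne_i) fz ham_sym.
  case=> /IHk[p [ep lp sp]].
  exists (rcons p y); rewrite rcons_path last_rcons size_rcons ep lp sp.
  by rewrite fe /cube_adj -fz -/(ham _ _) ham_sym ham_flip.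
move=> x y; have [p [ep lp sp]] := upper _ _ _ (erefl (ham (f x) (f y))).
apply/eqP; rewrite eqn_leq -sp -{1}lp dist_le_size //=.
have /dist_walk[q [eq_q lq <-]] : connect e x y by apply/connectP; exists p.
by rewrite sp -lq lower.
Qed.

End Isometries.

Lemma cube_dist n (x y : cube n) : dist (@cube_adj n) x y = ham x y.
Proof.
apply: (@down_set_isometry _ _ _ id) => //; rewrite imset_id.
by apply/down_setP=> z t; rewrite !inE.
Qed.

Lemma isometric_embeddingP (T : finType) (e : rel T) m (f : {ffun T -> cube m}) :
  reflect (isometry e f) (isometric_embedding e f).
Proof.
apply: (iffP forallP) => [iso x y | iso x].
  by move/forallP/(_ y)/eqP: (iso x); rewrite cube_dist.
by apply/forallP=> y; rewrite cube_dist iso.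
Qed.

Section Classes.

Variables (T : finType) (e : rel T).
Hypothesis e_irr : irreflexive e.
Hypothesis e_conn : forall x y : T, connect e x y.

Lemma edge_dist x y : e x y = (dist e x y == 1).
Proof.
have [p [ep lp sp]] := dist_walk (e_conn x y).
apply/idP/eqP => [exy | d1]; last first.
  by move: ep lp sp; rewrite d1; case: p => [|z []] //= /andP[exz _] <-.
apply/eqP; rewrite eqn_leq (@dist_le_size _ _ x [:: y]) ?andbT /= ?exy //=.
rewrite -sp; case: p lp {ep sp} => //= eq_xy.
by rewrite -eq_xy e_irr in exy.
Qed.

Variable n : nat.

Section OneIsometry.

Variable f : T -> cube n.
Hypothesis f_iso : isometry e f.

Lemma edge_ham x y : e x y = (ham (f x) (f y) == 1).
Proof. by rewrite edge_dist f_iso. Qed.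

Definition used_coords : {set 'I_n} :=
  [set i | [exists x, exists y, f x i != f y i]].

(** An edge changes a single coordinate, so a condition on coordinate [i] alone
    selects the edges in direction [i]. *)
Definition coord_class (i : 'I_n) : {set {set T}} :=
  [set [set u.1; u.2] | u in [set u : T * T | e u.1 u.2 && (f u.1 i != f u.2 i)]].

Lemma coord_classP i E :
  reflect (exists a b, [/\ E = [set a; b], e a b & f b = flip (f a) i])
          (E \in coord_class i).
Proof.
apply: (iffP imsetP) => [[[a b]] | [a [b [-> ab fb]]]].
  rewrite inE /= => /andP[ab ne_i] ->; exists a, b; split=> //.
  by apply: ham1_flip ne_i; apply/eqP; rewrite -edge_ham.
by exists (a, b); rewrite // inE /= ab fb ffunE eqxx; case: (f a i).
Qed.

Lemma flip_edge a b i : f b = flip (f a) i -> e a b.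
Proof. by rewrite edge_ham => ->; rewrite ham_flip. Qed.

Lemma edgesP E :
  reflect (exists a b, E = [set a; b] /\ exists i, f b = flip (f a) i)
          (E \in edges e).
Proof.
rewrite inE; apply: (iffP existsP) => [[a /existsP[b /andP[]]] | [a [b [-> [i fb]]]]].
  rewrite edge_ham => /eqP/ham1_exists[i _ fb] /eqP->.
  by exists a, b; split=> //; exists i.
by exists a; apply/existsP; exists b; rewrite eqxx (flip_edge fb).
Qed.

(** An edge is an unordered pair, which does not record which end is which; the
    coordinate it flips is the same in both orientations. *)
Lemma set2_flip a b c d i : [set a; b] = [set c; d] ->
  f b = flip (f a) i -> f d = flip (f c) i.
Proof.
move=> eq_E fb; have ab := flip_edge fb.
have ne_ab : a != b by apply: contraTneq ab => ->; rewrite e_irr.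
have ca := set21 c d; have da := set22 c d; rewrite -eq_E in ca da.
have ne_cd : c != d.
  apply: contraNneq ne_ab => eq_cd; move: (set21 a b) (set22 a b).
  by rewrite eq_E eq_cd setUid !inE => /eqP-> /eqP->.
by case/set2P: ca ne_cd => ->; case/set2P: da => ->; rewrite ?eqxx // fb flipK.
Qed.

Lemma Theta_flip a b x y i j :
    f b = flip (f a) i -> f y = flip (f x) j ->
  Theta e [set a; b] [set x; y] = (i == j).
Proof.
move=> fb fy; apply/existsP/idP => [[a' /existsP[b' /existsP[x' /existsP[y']]]] | eq_ij].
  case/and3P=> /eqP eqE /eqP eqF.
  by rewrite !f_iso (set2_flip eqE fb) (set2_flip eqF fy) ham_theta.
exists a; apply/existsP; exists b; apply/existsP; exists x; apply/existsP; exists y.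
by rewrite !eqxx !f_iso fb fy ham_theta.
Qed.

(** Along a path between two vertices that differ at [i], some edge flips [i]. *)
Lemma used_coordP i :
  reflect (exists a b, f b = flip (f a) i) (i \in used_coords).
Proof.
rewrite inE; apply: (iffP idP) => [|[a [b fb]]]; last first.
  apply/existsP; exists a; apply/existsP; exists b.
  by rewrite fb ffunE eqxx; case: (f a i).
case/existsP=> x /existsP[y ne_xy].
have [[a b] /= /andP[ab ne_i]|noflip] :=
  pickP (fun u : T * T => e u.1 u.2 && (f u.1 i != f u.2 i)).
  by exists a, b; apply: ham1_flip ne_i; apply/eqP; rewrite -edge_ham.
case/eqP: ne_xy; apply: (connected_constant (g := fun x => f x i) e_conn).
by move=> a b ab; move: (noflip (a, b)); rewrite /= ab; case: eqVneq.
Qed.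

(** By [Theta_flip], the block of an edge consists of the edges flipping the same
    coordinate. *)
Lemma Theta_classesE : Theta_classes e = coord_class @: used_coords.
Proof.
have class_of a b i : f b = flip (f a) i ->
    [set F in edges e | Theta e [set a; b] F] = coord_class i.
  move=> fb; apply/setP=> F; rewrite inE.
  apply/andP/coord_classP => [[/edgesP[x [y [-> [j fy]]]]] | [x [y [-> xy fy]]]].
    by rewrite (Theta_flip fb fy) => /eqP->; exists x, y; rewrite (flip_edge fy).
  rewrite (Theta_flip fb fy) eqxx; split=> //.
  by apply/edgesP; exists x, y; split=> //; exists i.
apply/setP=> C; apply/imsetP/imsetP => [[E /edgesP[a [b [-> [i fb]]]] ->] | [i]].
  by rewrite (class_of a b i fb); exists i => //; apply/used_coordP; exists a, b.
case/used_coordP=> a [b fb] ->; exists [set a; b]; last by rewrite (class_of a b i).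
by apply/edgesP; exists a, b; split=> //; exists i.
Qed.

Lemma coord_class_inj : {in used_coords &, injective coord_class}.
Proof.
move=> i j /used_coordP[a [b fb]] _ eq_ij.
have: [set a; b] \in coord_class i.
  by apply/coord_classP; exists a, b; rewrite (flip_edge fb).
rewrite eq_ij => /coord_classP[c [d [eqE _ fd]]].
have := set2_flip eqE fb; rewrite fd => /ffunP/(_ i); rewrite !ffunE eqxx.
by have [//|_] := eqVneq i j; case: (f c i).
Qed.

Lemma card_used_coords : #|used_coords| = isometric_dim e.
Proof. by rewrite /isometric_dim Theta_classesE card_in_imset //; apply: coord_class_inj. Qed.

Lemma Wset_flip a b i : f b = flip (f a) i ->
  Wset e a b = [set x | f a i == f x i].
Proof. by move=> fb; apply/setP=> x; rewrite !inE !f_iso fb ham_flip_lt. Qed.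

(** Every vertex lies in one of the two halfspaces of a class, so two-sided
    peripherality says that each vertex has its neighbour across the class. *)
Lemma two_sided_peripheralE i : i \in used_coords ->
  two_sided_peripheral e (coord_class i)
    = [forall x, flip (f x) i \in f @: [set: T]].
Proof.
case/used_coordP=> a [b fb].
have fa : f a = flip (f b) i by rewrite fb flipK.
have Eab : [set a; b] \in coord_class i.
  by apply/coord_classP; exists a, b; rewrite (flip_edge fb).
apply/forallP/forallP => [per x | closed W].
  have [W halfW xW] : exists2 W, halfspace e (coord_class i) W & x \in W.
    have [eq_i|ne_i] := eqVneq (f a i) (f x i).
      exists (Wset e a b); last by rewrite (Wset_flip fb) inE eq_i.
      by apply/existsP; exists a; apply/existsP; exists b; rewrite Eab eqxx.
    exists (Wset e b a).
      by apply/existsP; exists b; apply/existsP; exists a; rewrite setUC Eab eqxx.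
    rewrite (Wset_flip fa) inE fb ffunE eqxx.
    by move: ne_i; case: (f a i) (f x i) => [] [].
  move/implyP/(_ halfW)/eqP: (per W) => eqW.
  move: xW; rewrite -eqW inE => /andP[_ /existsP[E /andP[/coord_classP]]].
  case=> c [d [-> _ fd]] /set2P[] ->; first by rewrite -fd imset_f.
  by rewrite fd flipK imset_f.
apply/implyP=> _; apply/eqP/setP=> x; rewrite inE andb_idr // => _.
have /imsetP[y _ fy] := closed x.
apply/existsP; exists [set x; y]; rewrite set21 andbT; apply/coord_classP.
by exists x, y; rewrite (flip_edge (esym fy)).
Qed.

End OneIsometry.

End Classes.

(** * Comparing embeddings of minimum dimension *)

Section MinimumDimension.

Variables (T : finType) (e : rel T).
Hypothesis e_irr : irreflexive e.
Hypothesis e_conn : forall x y : T, connect e x y.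

Local Notation m := (isometric_dim e).

(** There are as many used coordinates as classes, so none is constant. *)
Lemma used_coords_min (f : T -> cube m) : isometry e f -> used_coords f = setT.
Proof.
move=> f_iso; apply/eqP.
by rewrite eqEcard subsetT cardsT card_ord (card_used_coords e_irr e_conn f_iso) /=.
Qed.

(** Coordinates of two embeddings correspond when they cut the same class. Over
    an edge two such coordinates change together, so over the connected graph
    they are equal or complementary. *)
Lemma isometry_rigid (f g : T -> cube m) : isometry e f -> isometry e g ->
  exists (s : 'S_m) (c : cube m),
    forall x i, g x i = translate c (f x) (s i).
Proof.
move=> f_iso g_iso.
have cls_g i : exists j, coord_class e f j == coord_class e g i.
  have : coord_class e g i \in Theta_classes e.
    by rewrite (Theta_classesE e_irr e_conn g_iso) imset_f ?used_coords_min ?inE.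
  rewrite (Theta_classesE e_irr e_conn f_iso) => /imsetP[j _ eqj].
  by exists j; rewrite eqj.
pose t i := xchoose (cls_g i).
have tP i : coord_class e f (t i) = coord_class e g i by apply/eqP/(xchooseP (cls_g i)).
have t_inj : injective t.
  move=> i j eq_t; apply: (coord_class_inj e_irr e_conn g_iso).
  - by rewrite used_coords_min ?inE.
  - by rewrite used_coords_min ?inE.
  by rewrite -!tP eq_t.
have same x y i : g x i (+) f x (t i) = g y i (+) f y (t i).
  apply: (connected_constant (g := fun x => g x i (+) f x (t i)) e_conn).
  move=> {x y} a b ab.
  have mem (h : T -> cube m) (h_iso : isometry e h) k :
      ([set a; b] \in coord_class e h k) = (h a k != h b k).
    apply/(coord_classP e_irr e_conn h_iso)/idP => [[c [d [eqE _ hd]]] | ne_k].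
      rewrite (set2_flip e_irr e_conn h_iso (esym eqE) hd) ffunE eqxx.
      by case: (h a k).
    exists a, b; split=> //; apply: ham1_flip ne_k.
    by apply/eqP; rewrite -(edge_ham e_irr e_conn h_iso).
  have := mem g g_iso i; rewrite -tP (mem f f_iso).
  by case: (g a i) (g b i) (f a (t i)) (f b (t i)) => [] [] [] [].
pose s := perm t_inj.
have [x0 _|T0] := pickP T; last by exists s, [ffun=> false] => x; have := T0 x.
exists s, [ffun j => g x0 ((s^-1)%g j) (+) f x0 j] => x i.
rewrite !ffunE permK permE (same x0 x).
by rewrite addbC addbK.
Qed.

(** Some edge flips the [i]-th coordinate of [f] and no other one. It changes the
    left-hand side of the hypothesis at [i], hence also the right-hand side, so
    [s i = i]; thus the permutation is trivial. *)
Lemma translate_rigid (f : T -> cube m) (c c' : cube m) (s : 'S_m) :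
    isometry e f ->
    (forall x i, translate c' (f x) i = translate c (f x) (s i)) ->
  c = c'.
Proof.
move=> f_iso eq_cc'; have s1 i : s i = i.
  have : i \in used_coords f by rewrite used_coords_min ?inE.
  case/(used_coordP e_irr e_conn f_iso)=> a [b fb].
  have := eq_cc' b i; have := eq_cc' a i; rewrite !ffunE fb !ffunE eqxx.
  have [//|_] := eqVneq (s i) i.
  by case: (f a i) (f a (s i)) (c i) (c' i) (c (s i)) => [] [] [] [] [].
have [x0 _|T0] := pickP T.
  apply/ffunP=> i; move: (eq_cc' x0 i); rewrite s1 !ffunE.
  by move/addbI->.
(* Without vertices there are no classes, hence no coordinates. *)
apply/ffunP=> i; have : i \in used_coords f by rewrite used_coords_min ?inE.
by rewrite inE => /existsP[x]; have := T0 x.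
Qed.

End MinimumDimension.

(** * Existence of a proper embedding *)

Section Existence.

Variables (T : finType) (e : rel T).
Hypothesis e_irr : irreflexive e.
Hypothesis e_conn : forall x y : T, connect e x y.

(** Coordinates constant on the graph contribute nothing to distances; deleting
    them leaves one coordinate per class. *)
Lemma exists_proper_embedding : daisy_cube e ->
  exists f : {ffun T -> cube (isometric_dim e)},
    isometry e f /\ down_set (f @: [set: T]).
Proof.
case=> n [D [f [_ dD f_inj imf fe]]]; rewrite -imf in dD.
have f_iso := down_set_isometry dD f_inj fe.
pose I := used_coords f.
have cardI : isometric_dim e = #|I| by rewrite (card_used_coords e_irr e_conn f_iso).
pose k (i : 'I_(isometric_dim e)) := enum_val (cast_ord cardI i).
have kI i : k i \in I by apply: enum_valP.
have k_inj : injective k by move=> i j /enum_val_inj/cast_ord_inj.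
have k_onto j : j \in I -> exists i, k i = j.
  move=> Ij; exists (cast_ord (esym cardI) (enum_rank_in Ij j)).
  by rewrite /k cast_ordKV enum_rankK_in.
exists [ffun x => [ffun i => f x (k i)]]; split=> [x y|].
  rewrite f_iso !hamE (bigID (mem I)) /= [X in _ + X]big1 ?addn0 => [|j].
    have imk : I =i k @: setT.
      move=> j; apply/idP/imsetP => [/k_onto[i <-]|[i _ ->]]; last exact: kI.
      by exists i.
    rewrite (eq_bigl _ _ imk) big_imset /=; last by move=> ? ? _ _; apply: k_inj.
    by apply: eq_big => [i|i _]; rewrite ?inE ?ffunE.
  rewrite inE negb_exists => /forallP/(_ x); rewrite negb_exists => /forallP/(_ y).
  by move/negbNE ->.
apply/down_setP=> x _ /imsetP[z _ ->] le_xz.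
(* Extend [x] by [false] to the deleted coordinates, to stay below [f z]. *)
pose w : cube n := [ffun j => [exists i, (k i == j) && x i]].
have wk i : w (k i) = x i.
  rewrite ffunE; apply/existsP/idP => [[j /andP[/eqP/k_inj->]] // | xi].
  by exists i; rewrite eqxx.
have /imsetP[z' _ wz'] : w \in f @: [set: T].
  apply: (elimT (down_setP _) dD w (f z) (imset_f _ (in_setT z))) => j.
  by rewrite ffunE => /existsP[i /andP[/eqP<- /le_xz]]; rewrite !ffunE.
by apply/imsetP; exists z' => //; apply/ffunP=> i; rewrite !ffunE -wz' wk.
Qed.

End Existence.

(** * Permutations of coordinates *)

Lemma coord_perm_equivP (T : finType) m (f g : {ffun T -> cube m}) :
  reflect (exists s : 'S_m, forall x i, g x i = f x (s i)) (coord_perm_equiv f g).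
Proof.
apply: (iffP existsP) => [[s eq_s] | [s eq_s]]; exists s.
  by move=> x i; apply/eqP; have /forallP/(_ x)/forallP := eq_s.
by apply/forallP=> x; apply/forallP=> i; rewrite eq_s.
Qed.

Lemma coord_perm_equiv_sym (T : finType) m : symmetric (@coord_perm_equiv T m).
Proof.
suff half f g : @coord_perm_equiv T m f g -> coord_perm_equiv g f.
  by move=> f g; apply/idP/idP; apply: half.
case/coord_perm_equivP=> s eq_s; apply/coord_perm_equivP; exists (s^-1)%g => x i.
by rewrite eq_s permKV.
Qed.

Lemma coord_perm_equiv_trans (T : finType) m : transitive (@coord_perm_equiv T m).
Proof.
move=> g f h /coord_perm_equivP[s gs] /coord_perm_equivP[t ht].
by apply/coord_perm_equivP; exists (t * s)%g => x i; rewrite ht gs permM.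
Qed.

Lemma down_set_perm (T : finType) m (f g : {ffun T -> cube m}) :
  coord_perm_equiv f g -> down_set (g @: [set: T]) -> down_set (f @: [set: T]).
Proof.
case/coord_perm_equivP=> s gs /down_setP dg.
apply/down_setP=> y _ /imsetP[z _ ->] le_yz.
have /imsetP[w _ yw] : [ffun i => y (s i)] \in g @: [set: T].
  by apply: dg (imset_f g (in_setT z)) _ => i; rewrite ffunE gs; apply: le_yz.
apply/imsetP; exists w => //; apply/ffunP=> i.
by have /ffunP/(_ (s^-1 i)%g) := yw; rewrite ffunE gs permKV.
Qed.

(** * Counting *)

Theorem corollary7 (T : finType) (e : rel T)
    (e_sym : symmetric e) (e_irr : irreflexive e)
    (e_conn : forall x y : T, connect e x y)
    (e_daisy : daisy_cube e) :
  #|proper_embedding_classes e (isometric_dim e)|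
    = 2 ^ #|[set theta in Theta_classes e | two_sided_peripheral e theta]|.
Proof.
have [f [f_iso dD]] := exists_proper_embedding e_irr e_conn e_daisy.
set D := f @: _ in dD; set m := isometric_dim e in f f_iso D dD *.
have used i : i \in used_coords f by rewrite used_coords_min ?inE.
pose P := [set i | [forall x, flip (f x) i \in D]].
have cardP : #|[set theta in Theta_classes e | two_sided_peripheral e theta]| = #|P|.
  rewrite -(card_in_imset (f := coord_class e f) (D := P)); last first.
    by move=> i j _ _; apply: coord_class_inj.
  apply: eq_card => theta; rewrite inE (Theta_classesE e_irr e_conn f_iso).
  apply/andP/imsetP => [[/imsetP[i _ ->]] | [i Pi ->]].
    by rewrite two_sided_peripheralE // => Pi; exists i; rewrite // inE.
  by rewrite imset_f // two_sided_peripheralE //; rewrite inE in Pi.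
rewrite cardP -card_powerset.
pose emb (c : cube m) : {ffun T -> cube m} := [ffun x => translate c (f x)].
have emb_iso c : isometry e (emb c).
  by move=> x y; rewrite !ffunE ham_translate f_iso.
have emb_proper c : (emb c \in proper_embeddings e m) = ([set i | c i] \subset P).
  rewrite inE; have -> /= : isometric_embedding e (emb c) by apply/isometric_embeddingP.
  have -> : emb c @: [set: T] = translate c @: D.
    by rewrite -imset_comp; apply: eq_imset => x; rewrite ffunE.
  rewrite down_set_translate //; apply/forallP/subsetP => [closed i | sub_cP i].
    rewrite !inE => ci; apply/forallP=> x.
    by have /implyP/(_ ci)/forall_inP := closed i; apply; rewrite imset_f.
  apply/implyP=> ci; apply/forall_inP=> _ /imsetP[x _ ->].
  by have := sub_cP i; rewrite !inE => /(_ ci)/forallP.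
(* Each class contains exactly one translate [emb c], and [c] is determined by
   its support. *)
pose block g := [set h in proper_embeddings e m | coord_perm_equiv g h].
pose ind (A : {set 'I_m}) : cube m := [ffun i => i \in A].
have indK A : [set i | ind A i] = A by apply/setP=> i; rewrite inE ffunE.
rewrite -(card_in_imset (f := block \o emb \o ind)).
  apply: eq_card => B; apply/imsetP/imsetP => [[g PEg ->] | [A]]; last first.
    by rewrite inE => sAP -> /=; exists (emb (ind A)); rewrite ?emb_proper ?indK.
  have [/isometric_embeddingP g_iso dg] : isometric_embedding e g /\ down_set (g @: [set: T]).
    by apply/andP; rewrite inE in PEg.
  have [s [c gs]] := isometry_rigid e_irr e_conn f_iso g_iso.
  have eq_g : coord_perm_equiv (emb c) g.
    by apply/coord_perm_equivP; exists s => x i; rewrite gs [emb c x]ffunE.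
  have PEc : emb c \in proper_embeddings e m.
    by rewrite inE (down_set_perm eq_g dg) andbT; apply/isometric_embeddingP.
  exists [set i | c i]; first by rewrite inE -emb_proper.
  have -> : (block \o emb \o ind) [set i | c i] = block (emb c).
    by congr (block (emb _)); apply/ffunP=> i; rewrite ffunE inE.
  apply/setP=> h; rewrite !inE; congr (_ && _).
  apply: esym; move: eq_g h; apply: sym_left_transitive.
    exact: coord_perm_equiv_sym.
  exact: coord_perm_equiv_trans.
move=> A A' _ sA' /= eq_block; suff eq_ind : ind A = ind A' by rewrite -[A]indK eq_ind indK.
have: emb (ind A') \in block (emb (ind A)).
  rewrite eq_block inE emb_proper indK -powersetE sA'.
  by apply/coord_perm_equivP; exists 1%g => x i; rewrite perm1.
rewrite inE => /andP[_ /coord_perm_equivP[s eq_s]].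
apply: (translate_rigid e_irr e_conn f_iso (s := s)) => x i.
by have := eq_s x i; rewrite !ffunE.
Qed.
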